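(* Let $A\in\mathcal{PC}_{n}$ be a column perturbed consistent matrix. Then $\mathcal{C}(A)\subseteq\mathcal{E}(A)$; that is, every nonzero, nonnegative linear combination of the columns of $A$ is efficient for $A$.
   Context: An $n$-by-$n$ entrywise positive real matrix $A=[a_{ij}]$ is reciprocal if $a_{ji}=1/a_{ij}$ for all $1\le i,j\le n$ (so diagonal entries are $1$); $\mathcal{PC}_n$ denotes the set of such matrices. A matrix $A\in\mathcal{PC}_n$ is consistent if $a_{ik}=a_{ij}a_{jk}$ for all $i,j,k$ (equivalently $A=ww^{(-T)}$ for some positive vector $w$). Here, for an entrywise positive vector $w\in\mathbb{R}^n$, $w^{(-T)}$ is the row vector with entries $1/w_j$, so $ww^{(-T)}=[w_i/w_j]$. $A\in\mathcal{PC}_n$ is a column perturbed consistent matrix if it has a consistent $(n-1)$-by-$(n-1)$ principal submatrix, i.e., there is an index $k$ such that $a_{il}=a_{ij}a_{jl}$ for all $i,j,l\in\{1,\dots,n\}\setminus\{k\}$ (equivalently, $A$ is a reciprocal matrix obtained from a consistent matrix by modifying one column and the corresponding row). A positive vector $w\in\mathbb{R}^n$ is efficient for $A\in\mathcal{PC}_n$ if for every positive vector $v\in\mathbb{R}^n$, the entrywise inequality $|A-vv^{(-T)}|\le |A-ww^{(-T)}|$ (entrywise absolute values) implies that $v$ is proportional to $w$. $\mathcal{E}(A)$ denotes the set of all positive vectors efficient for $A$. $\mathcal{C}(A)$ denotes the convex cone generated by the columns of $A$, i.e., the set of nonzero, nonnegative linear combinations of the columns of $A$ (so $0\notin\mathcal{C}(A)$).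 *)

(* Defs.v *)
From HB Require Import structures.
From mathcomp Require Import all_boot all_order all_algebra.
From mathcomp Require Import boolp classical_sets reals.

Set Implicit Arguments.
Unset Strict Implicit.
Unset Printing Implicit Defensive.

Import Order.TTheory GRing.Theory Num.Theory.
Local Open Scope classical_set_scope.
Local Open Scope ring_scope.

Section ReciprocalMatrices.
Variables (R : realType) (n : nat).
Implicit Types (A : 'M[R]_n) (w v : 'cV[R]_n).

Definition PC : set 'M[R]_n :=
  [set A | (forall i j, 0 < A i j) /\ (forall i j, A j i = (A i j)^-1)].

Definition consistent A : Prop :=
  PC A /\ forall i j k, A i k = A i j * A j k.

Definition positive_vec w : Prop := forall i, 0 < w i 0.

Definition inv_tr w : 'rV[R]_n := \row_j (w j 0)^-1.

Definition efficient A : set 'cV[R]_n :=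
  [set w | positive_vec w /\
    forall v, positive_vec v ->
      (forall i j, `|(A - v *m inv_tr v) i j| <= `|(A - w *m inv_tr w) i j|) ->
      exists c : R, v = c *: w].

Definition col_cone A : set 'cV[R]_n :=
  [set w | w != 0 /\
    exists c : 'I_n -> R, (forall j, 0 <= c j) /\
      w = \sum_(j < n) c j *: col j A].

End ReciprocalMatrices.

(* [row' k (col' k A)] is the principal submatrix of [A] obtained by deleting
   row and column [k]. *)
Definition column_perturbed (R : realType) (n : nat) (A : 'M[R]_n) : Prop :=
  PC A /\ exists k : 'I_n, consistent (row' k (col' k A)).

(* Main.v *)
Require Import Defs.
From mathcomp Require Import all_boot all_order all_algebra.
From mathcomp Require Import boolp classical_sets reals.

Set Implicit Arguments.
Unset Strict Implicit.
Unset Printing Implicit Defensive.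

Import Order.TTheory GRing.Theory Num.Theory.
Local Open Scope classical_set_scope.
Local Open Scope ring_scope.

(** Say that [i] dominates [j] when [A i j * A j l <= A i l] for every column
    [l]. Then [A i j <= w i / w j] for every [w] in the cone of the columns, so
    any [v] approximating [A] entrywise at least as well as [w] has
    [v i / v j <= w i / w j], i.e. [v / w] increases from [i] to [j].
    If [A] is consistent outside the index [k], write [A i j = u i / u j] there:
    the indices other than [k] are totally ordered by domination, according to
    the size of [A i k / u i]; a smallest one dominates [k], and [k] dominates a
    largest one. This closes a cycle through all indices, so [v / w] is
    constant. *)

Definition dominates (R : realType) (n : nat) (A : 'M[R]_n) (i j : 'I_n) : Prop :=
  forall l, A i j * A j l <= A i l.

Lemma col_coneE (R : realType) (n : nat) (A : 'M[R]_n) (c : 'I_n -> R) i :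
  (\sum_(j < n) c j *: col j A) i 0 = \sum_(j < n) c j * A i j.
Proof. by rewrite summxE; apply: eq_bigr => j _; rewrite !mxE. Qed.

Lemma col_cone_positive (R : realType) (n : nat) (A : 'M[R]_n) (w : 'cV[R]_n) :
  PC A -> col_cone A w -> positive_vec w.
Proof.
move=> [A_gt0 _] [w_neq0 [c [c_ge0 w_def]]] i.
have ge0 j : true -> 0 <= c j * A i j by move=> _; rewrite mulr_ge0 // ltW.
rewrite w_def col_coneE lt_def sumr_ge0 // andbT.
(* A zero entry would be a vanishing sum of nonnegative terms; as [A i j > 0], every [c j] would
   then be zero. *)
apply: contra w_neq0 => /eqP sum0; rewrite w_def; apply/eqP.
apply: big1 => j _; have /eqP := psumr_eq0P ge0 sum0 (i := j) isT.
by rewrite mulf_eq0 (gt_eqF (A_gt0 i j)) orbF => /eqP ->; rewrite scale0r.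
Qed.

Lemma dominates_col_cone (R : realType) (n : nat) (A : 'M[R]_n) (w : 'cV[R]_n) i j :
  dominates A i j -> col_cone A w -> A i j * w j 0 <= w i 0.
Proof.
move=> dom_ij [_ [c [c_ge0 ->]]]; rewrite !col_coneE mulr_sumr.
by apply: ler_sum => l _; rewrite mulrCA ler_wpM2l.
Qed.

Lemma dominates_ratio (R : realType) (n : nat) (A : 'M[R]_n) (w v : 'cV[R]_n) i j :
  PC A -> col_cone A w -> positive_vec v ->
  (forall i j, `|(A - v *m inv_tr v) i j| <= `|(A - w *m inv_tr w) i j|) ->
  dominates A i j -> v i 0 / w i 0 <= v j 0 / w j 0.
Proof.
move=> A_PC Aw v_gt0 le_vw dom_ij; have w_gt0 := col_cone_positive A_PC Aw.
have := le_vw i j; rewrite !mxE !big_ord1 !mxE.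
have leAw : A i j <= w i 0 / w j 0.
  by rewrite ler_pdivlMr //; apply: dominates_col_cone.
(* The error of [w] has a known sign; for [v], [x <= |x|] suffices, and [A i j] cancels. *)
rewrite (ler0_norm (x := A i j - w i 0 / w j 0)) ?subr_le0 // opprB distrC.
move=> /(le_trans (ler_norm _)); rewrite lerD2r.
by rewrite !ler_pdivrMr // mulrAC [v j 0 / _ * _]mulrAC [v j 0 * _]mulrC.
Qed.

Section ColumnPerturbed.
Variables (R : realType) (n : nat) (A : 'M[R]_n) (k : 'I_n).
Hypothesis A_PC : PC A.
Hypothesis A_cons : consistent (row' k (col' k A)).

Lemma consistent_off (i j l : 'I_n) :
  i != k -> j != k -> l != k -> A i l = A i j * A j l.
Proof.
rewrite ![_ == k]eq_sym.
move=> /unlift_some[i' -> _] /unlift_some[j' -> _] /unlift_some[l' -> _].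
by have := A_cons.2 i' j' l'; rewrite !mxE.
Qed.

Lemma PC_mulV (i j : 'I_n) : A i j * A j i = 1.
Proof. by rewrite (A_PC.2 i j) divff // gt_eqF ?A_PC.1. Qed.

Lemma PC_diag (i : 'I_n) : A i i = 1.
Proof.
by apply/eqP; rewrite -(@pexpr_eq1 _ _ 2) ?ltW ?A_PC.1 // expr2 PC_mulV.
Qed.

(** By consistency, every column other than [k] gives an equality, so only column [k] imposes a
    condition. *)
Lemma dominates_off (i j : 'I_n) : i != k -> j != k ->
  A i j * A j k <= A i k -> dominates A i j.
Proof.
move=> ik jk le_k l; have [->//|lk] := eqVneq l k.
by rewrite -(consistent_off ik jk lk).
Qed.

Lemma dominates_pivot (i : 'I_n) :
  (forall l, l != k -> A i k <= A i l * A l k) -> dominates A i k.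
Proof.
move=> le_i l; have [->|lk] := eqVneq l k; first by rewrite PC_diag mulr1.
by rewrite (A_PC.2 l k) ler_pdivrMr ?A_PC.1 // le_i.
Qed.

(** Column [k] gives an equality by reciprocity; in any other column, inverting the entries of row
    [k] yields the hypothesis. *)
Lemma pivot_dominates (i : 'I_n) :
  (forall l, l != k -> A i l * A l k <= A i k) -> dominates A k i.
Proof.
move=> le_i l; have [->|lk] := eqVneq l k; first by rewrite PC_mulV PC_diag.
rewrite (A_PC.2 i k) (A_PC.2 l k) mulrC ler_pdivrMr ?A_PC.1 //.
by rewrite mulrC ler_pdivlMr ?A_PC.1 // le_i.
Qed.

(* [A i0 i * A i k] is a positive multiple of [A i k / u i]. *)
Lemma le_pivot (i0 i j : 'I_n) : i0 != k -> i != k -> j != k ->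
  (A i0 j * A j k <= A i0 i * A i k) = (A i j * A j k <= A i k).
Proof.
move=> i0k ik jk.
by rewrite (consistent_off i0k ik jk) -mulrA ler_pM2l ?A_PC.1.
Qed.

Lemma ge_pivot (i0 i j : 'I_n) : i0 != k -> i != k -> j != k ->
  (A i0 i * A i k <= A i0 j * A j k) = (A i k <= A i j * A j k).
Proof.
move=> i0k ik jk.
by rewrite (consistent_off i0k ik jk) -mulrA ler_pM2l ?A_PC.1.
Qed.

Lemma dominates_cycle_constant (r : 'I_n -> R) :
  (forall i j, dominates A i j -> r i <= r j) -> forall i, r i = r k.
Proof.
move=> r_mono i; have [->//|ik] := eqVneq i k.
(* The given [i] serves as the reference row and shows that there are indices other than [k]. The
   cycle is [a], [k], [b], [i], [a], each index dominating the next. *)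
pose x j := A i j * A j k.
case: (arg_minP (P := fun j => j != k) x ik) => a ak a_min.
case: (arg_maxP (P := fun j => j != k) x ik) => b bk b_max.
have r_ak : r a <= r k.
  by apply/r_mono/dominates_pivot => l lk; rewrite -(ge_pivot ik) //; exact: a_min.
have r_kb : r k <= r b.
  by apply/r_mono/pivot_dominates => l lk; rewrite -(le_pivot ik) //; exact: b_max.
have r_bi : r b <= r i.
  by apply/r_mono/dominates_off; rewrite // -(le_pivot ik) //; exact: b_max.
have r_ia : r i <= r a.
  by apply/r_mono/dominates_off; rewrite // -(le_pivot ik) //; exact: a_min.
by apply/eqP; rewrite eq_le (le_trans r_ia r_ak) (le_trans r_kb r_bi).
Qed.

End ColumnPerturbed.

Theorem theorem13 (R : realType) (n : nat) (A : 'M[R]_n)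
  (hA : column_perturbed A) : col_cone A `<=` efficient A.
Proof.
case: hA => A_PC [k A_cons] w Aw.
have w_gt0 := col_cone_positive A_PC Aw; split=> // v v_gt0 le_vw.
exists (v k 0 / w k 0); apply/colP => i; rewrite mxE.
have <- := dominates_cycle_constant A_PC A_cons (r := fun i => v i 0 / w i 0)
  (fun i j => dominates_ratio A_PC Aw v_gt0 le_vw) i.
by rewrite divfK // gt_eqF.
Qed.
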